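(* Let $r>0$, let $D_r = \{z\in\mathbb{C}: |z|<r\}$, and let $\overline{D_r}$ be its closure. Let $C_{\overline{D_r}}$ be the smallest constant $C>0$ such that $$\|q\|_{\overline{D_r}} \le C^n \,\|p\|_{\overline{D_r}}, \qquad n=\deg p,$$ holds for every monic polynomial $p$ with complex coefficients and every monic factor $q$ of $p$. Then $$C_{\overline{D_r}} = \begin{cases} \dfrac{1}{r}, & 0<r \le 1/2, \\[2ex] \dfrac{1}{r} \exp \left(\dfrac{1}{\pi} \displaystyle\int_0^{\pi-2\arcsin\frac{1}{2r}} \log\left(2 r \cos\frac{x}{2}\right) dx \right), & r>1/2. \end{cases}$$
   Context: For a compact set $E\subset\mathbb{C}$, $\|f\|_E = \sup_{z\in E}|f(z)|$. A monic factor of a monic polynomial $p$ is a monic complex polynomial $q$ such that $p=qr$ for some (monic) complex polynomial $r$. *)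

(* Defs.v *)
From HB Require Import structures.
From mathcomp Require Import all_boot all_order all_algebra.
From mathcomp Require Import all_classical all_reals all_analysis.
From mathcomp Require Import complex.
Set Implicit Arguments.
Unset Strict Implicit.
Unset Printing Implicit Defensive.
Import Order.TTheory GRing.Theory Num.Theory.
Import numFieldNormedType.Exports.
Local Open Scope classical_set_scope.
Local Open Scope ring_scope.
Local Open Scope complex_scope.

Definition monic_factor (F : fieldType) (q p : {poly F}) : Prop :=
  q \is monic /\ exists s : {poly F}, p = q * s.

(* The values are taken in R through [normc], because [`|z|] lives in R[i].
   The supremum is the usual one only if E is nonempty and p is bounded on E,
   as it is for every nonempty compact set; otherwise [sup] returns 0. *)
Definition sup_norm (R : realType) (E : set R[i]) (p : {poly R[i]}) : R :=
  sup [set ComplexField.Normc.normc p.[z] | z in E].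

(* For p monic, hence nonzero, the degree of p is [(size p).-1]. *)
Definition factor_constants (R : realType) (E : set R[i]) : set R :=
  [set C | 0 < C /\ forall p q : {poly R[i]}, p \is monic ->
     monic_factor q p -> sup_norm E q <= C ^+ (size p).-1 * sup_norm E p].

Definition smallest_factor_constant (R : realType) (E : set R[i]) (C : R) :
  Prop := factor_constants E C /\ lbound (factor_constants E) C.

Definition open_disk (R : realType) (r : R) : set R[i] :=
  [set z | ComplexField.Normc.normc z < r].

(* R[i] gets its topology, induced by the modulus, from its structure of
   numFieldType. *)
Definition closed_disk (R : realType) (r : R) : set R[i] :=
  @closure (R[i] : numFieldType) (open_disk r).

(* Main.v *)
(** For [p = \prod_j (X - z_j)] and [|u| = r], every monic factor [q] of [p]
    satisfies [|q(u)| <= \prod_j max(1, |u - z_j|)].  By Jensen's formula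
    [log max(1, |w|)] is the mean of [log |w - e^(it)|], so the logarithm of this
    product is the mean of [log |p|] over the unit circle around [u], where the
    Bernstein-Walsh inequality gives [|p(v)| <= ||p|| max(1, |v|/r)^n].  Jensen's
    formula on the circle [|v| = r] turns the mean of [log max(1, |v|/r)] into
    [- log r] plus the mean of [log max(1, |u - r e^(it)|)], which is the
    constant.  All the means over circles are taken over roots of unity:
    [\prod_(k < N) (w - y omega^k) = w^N - y^N] replaces the Jensen integrals, at
    the price of errors that vanish as [N] grows, and the only integral is that
    of the decreasing function [log max(1, 2 r cos(x/2))] on [0, pi], compared
    with its Riemann sums.  Equality is attained asymptotically by [X^n - r^n]. *)

Require Import Defs.
From mathcomp Require Import all_boot all_order all_algebra.
From mathcomp Require Import all_classical all_reals all_analysis.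
From mathcomp Require Import complex.
From mathcomp Require Import zify ring lra.
Import Order.TTheory GRing.Theory Num.Theory.
Import numFieldNormedType.Exports.
Local Open Scope classical_set_scope.
Local Open Scope ring_scope.

Local Notation normc := ComplexField.Normc.normc.

(** * Roots of unity *)

Section RootsOfUnity.
Variables (F : numFieldType) (N : nat) (z : F).
Hypothesis pz : N.-primitive_root z.

Lemma prim_root_neq0 : z != 0.
Proof.
apply/eqP => z0; have := prim_expr_order pz.
rewrite z0 expr0n gtn_eqF ?(prim_order_gt0 pz) // => /esym/eqP.
by rewrite oner_eq0.
Qed.

Lemma prod_sub_unity_roots x y :
  \prod_(k < N) (x - y * z ^+ k) = x ^+ N - y ^+ N.
Proof.
have N0 := prim_order_gt0 pz.
have [->|y0] := eqVneq y 0.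
  under eq_bigr do rewrite mul0r subr0.
  by rewrite prodr_const card_ord expr0n gtn_eqF ?subr0.
have := congr1 (fun p : {poly F} => p.[x / y]) (factor_Xn_sub_1 pz).
rewrite horner_prod big_mkord !hornerE expr_div_n => H.
have -> : x ^+ N - y ^+ N = y ^+ N * (x ^+ N / y ^+ N - 1).
  by rewrite mulrBr mulr1 mulrC divfK // expf_neq0.
rewrite -H; have -> : y ^+ N = \prod_(k < N) y by rewrite prodr_const card_ord.
rewrite -big_split /=; apply: eq_bigr => i _.
by rewrite !hornerE mulrBr mulrCA mulfV ?mulr1.
Qed.

Lemma unity_roots_orthogonal (i j : 'I_N) :
  \sum_(k < N) (z ^+ k) ^+ i / (z ^+ k) ^+ j = (i == j)%:R * N%:R.
Proof.
have z0 := prim_root_neq0.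
pose x := z ^+ i / z ^+ j.
have -> : \sum_(k < N) (z ^+ k) ^+ i / (z ^+ k) ^+ j = \sum_(k < N) x ^+ k.
  by apply: eq_bigr => k _; rewrite expr_div_n -!exprM mulnC (mulnC k j).
have [eij|ij] := eqVneq i j.
  rewrite mul1r /x eij divff ?expf_neq0 //.
  by under eq_bigr do rewrite expr1n; rewrite sumr_const card_ord.
rewrite mul0r; have x1 : x - 1 != 0.
  rewrite subr_eq0; apply: contra ij; rewrite /x => /eqP H.
  have : z ^+ i == z ^+ j by rewrite -[_ ^+ i](divfK (expf_neq0 j z0)) H mul1r.
  by rewrite (eq_prim_root_expr pz) !modn_small // => /eqP/val_inj ->.
apply: (mulfI x1); rewrite mulr0 -subrX1 /x expr_div_n -!exprM.
by rewrite mulnC (mulnC j) !exprM (prim_expr_order pz) !expr1n divr1 subrr.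
Qed.

(** Lagrange interpolation at the points [w * z ^+ k], with the kernel left as a geometric sum.
    After expanding [f] in monomials, orthogonality keeps only the terms with [i = j]. *)
Lemma unity_roots_interpolation (f : {poly F}) (w x : F) :
  (size f <= N)%N -> w != 0 ->
  f.[x] * N%:R =
  \sum_(k < N) f.[w * z ^+ k] * \sum_(j < N) (x / (w * z ^+ k)) ^+ j.
Proof.
move=> sf w0.
have z0 := prim_root_neq0.
transitivity (\sum_(i < N) \sum_(j < N) \sum_(k < N)
   f`_i * w ^+ i * (x / w) ^+ j * ((z ^+ k) ^+ i / (z ^+ k) ^+ j)).
  rewrite (horner_coef_wide x sf) mulr_suml; apply: eq_bigr => i _.
  rewrite (bigD1 i) //= [X in _ = _ + X]big1 ?addr0 => [|j ji].
    rewrite -mulr_sumr unity_roots_orthogonal eqxx mul1r; congr (_ * _).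
    by rewrite expr_div_n -mulrA (mulrC (w ^+ i)) divfK // expf_neq0.
  by rewrite -mulr_sumr unity_roots_orthogonal eq_sym (negbTE ji) mul0r mulr0.
rewrite [RHS](eq_bigr (fun k : 'I_N => \sum_(i < N) \sum_(j < N)
   f`_i * w ^+ i * (x / w) ^+ j * ((z ^+ k) ^+ i / (z ^+ k) ^+ j))) => [|k _].
  by rewrite [RHS]exchange_big; apply: eq_bigr => i _; rewrite exchange_big.
rewrite (horner_coef_wide _ sf) mulr_suml; apply: eq_bigr => i _.
rewrite mulr_sumr; apply: eq_bigr => j _.
rewrite invfM mulrA; move: (x / w) => y; rewrite expr_div_n exprMn; ring.
Qed.

Lemma unity_roots_mean_value (f : {poly F}) :
  (size f <= N)%N -> f.[0] * N%:R = \sum_(k < N) f.[z ^+ k].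
Proof.
move=> sf; rewrite (unity_roots_interpolation _ 1) ?oner_neq0 //.
(* At [x = 0] the kernel reduces to its term [j = 0], because [0 ^+ 0 = 1]. *)
case: N (prim_order_gt0 pz) => // n _; apply: eq_bigr => k _.
by rewrite mul1r mul0r big_ord_recl expr0 big1 ?addr0 ?mulr1 // => i _; rewrite expr0n.
Qed.

End RootsOfUnity.

(** * Modulus and complex exponential *)

Section Modulus.
Variable R : realType.
Implicit Types (z w : R[i]) (x y : R).

Lemma normc_ge0 z : 0 <= normc z.
Proof. by case: z => a b; exact: sqrtr_ge0. Qed.

Lemma normcX z n : normc (z ^+ n) = normc z ^+ n.
Proof.
elim: n => [|n IH]; first exact: ComplexField.Normc.normc1.
by rewrite !exprS ComplexField.Normc.normcM IH.
Qed.

Lemma normc_prod I (s : seq I) (P : pred I) (f : I -> R[i]) :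
  normc (\prod_(i <- s | P i) f i) = \prod_(i <- s | P i) normc (f i).
Proof.
apply: (big_ind2 (fun a b => normc a = b)) => //.
  exact: ComplexField.Normc.normc1.
by move=> a b c d <- <-; rewrite ComplexField.Normc.normcM.
Qed.

Lemma normc_sum I (s : seq I) (P : pred I) (f : I -> R[i]) :
  normc (\sum_(i <- s | P i) f i) <= \sum_(i <- s | P i) normc (f i).
Proof.
apply: (big_ind2 (fun a b => normc a <= b)) => //.
  by rewrite ComplexField.Normc.normc0.
move=> a b c d ab cd; apply: le_trans (le_normcD _ _) _; exact: lerD.
Qed.

Lemma normc_real x : normc (x%:C)%C = `|x|.
Proof. by rewrite /normc /= expr0n /= addr0 sqrtr_sqr. Qed.

Lemma normc_nat n : normc n%:R = n%:R :> R.
Proof. by rewrite -[n%:R](rmorph_nat (real_complex R)) normc_real normr_nat. Qed.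

Lemma normc_conjc z : normc z^*%C = normc z.
Proof. by case: z => a b; rewrite /normc /= sqrrN. Qed.

Lemma normcBC z w : normc (z - w) = normc (w - z).
Proof. by rewrite -opprB normcN. Qed.

Definition expi x : R[i] := (cos x +i* sin x)%C.

Lemma expiD x y : expi (x + y) = expi x * expi y.
Proof. by rewrite /expi cosD sinD; simpc; congr (_ +i* _)%C; ring. Qed.

Lemma expi0 : expi 0 = 1.
Proof. by rewrite /expi cos0 sin0. Qed.

Lemma expiX x n : expi x ^+ n = expi (n%:R * x).
Proof.
elim: n => [|n IH]; first by rewrite mul0r expi0.
by rewrite exprS IH -expiD -natr1 mulrDl mul1r addrC.
Qed.

Lemma normc_expi x : normc (expi x) = 1.
Proof. by rewrite /normc /expi cos2Dsin2 sqrtr1. Qed.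

Lemma normc_1Dexpi x : normc (1 + expi x) = 2 * `|cos (x / 2)|.
Proof.
have -> : 1 + expi x = ((1 + cos x)%R +i* sin x)%C.
  by rewrite -[1 in LHS]/(1 +i* 0)%C /expi; simpc.
rewrite /=; have -> : (1 + cos x) ^+ 2 + sin x ^+ 2 = (2 * cos (x / 2)) ^+ 2.
  have {1 2}-> : x = (x / 2) *+ 2 by rewrite -mulr_natr divfK.
  by rewrite sin2cos2 !cos_mulr2n; ring.
by rewrite sqrtr_sqr normrM gtr0_norm.
Qed.

Definition omega n : R[i] := expi (2 * pi / n%:R).

Lemma normc_omegaX n k : normc (omega n ^+ k) = 1.
Proof. by rewrite normcX normc_expi expr1n. Qed.

Lemma expi_neq1 x : 0 < x < 2 * pi -> expi x != 1.
Proof.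
move=> /andP[x0 x2].
have s0 : 0 < sin (x / 2) by apply: sin_gt0_pi; lra.
apply/eqP => /(congr1 (@complex.Re R)) /=.
have -> : x = (x / 2) *+ 2 by rewrite -mulr_natr divfK.
rewrite cos_mulr2n cos2sin2; nra.
Qed.

Lemma omega_prim n : (0 < n)%N -> n.-primitive_root (omega n).
Proof.
move=> n0; have nR : (0 : R) < n%:R by rewrite ltr0n.
rewrite /primitive_root_of_unity n0 /=; apply/forallP => i.
rewrite unity_rootE expiX; apply/eqP.
case: (eqVneq i.+1 n) => [->|ni].
  rewrite mulrC divfK ?pnatr_eq0 -?lt0n // mulr_natl /expi cos2pi sin2pi.
  by rewrite eqxx.
apply/negbTE/expi_neq1; have iln : i.+1%:R < n%:R :> R.
  by rewrite ltr_nat ltn_neqAle ni ltn_ord.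
have := pi_gt0 R => pi0; rewrite mulrCA mulr_gt0 ?divr_gt0 ?ltr0n ?mulr_gt0 //=.
by rewrite gtr_pMr ?mulr_gt0 // ltr_pdivrMr // mul1r.
Qed.

End Modulus.

Arguments expi {R} x.

(** * Maximum principles for polynomials *)

(** If [b < a], the powers of [a / b] outgrow every linear function of the exponent. This removes
    the factor that a crude estimate picks up when applied to all powers of one polynomial. *)
Lemma ler_of_expr_le_linear (R : realType) (n : nat) (a b : R) :
  0 <= a -> 0 <= b ->
  (forall L : nat, a ^+ L <= (n * L + 1)%:R * b ^+ L) -> a <= b.
Proof.
move=> a0 b0 H; rewrite leNgt; apply/negP => ba.
have [b00|b1] := eqVneq b 0.
  by have := H 1%N; rewrite !expr1 b00 mulr0 leNgt -{1}b00 ba.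
have bp : 0 < b by rewrite lt_neqAle eq_sym b1.
pose s := a / b - 1.
have sp : 0 < s by rewrite subr_gt0 ltr_pdivlMr // mul1r.
have Hs L : (1 + s) ^+ L <= (n * L + 1)%:R.
  by rewrite /s addrC subrK expr_div_n ler_pdivrMr ?exprn_gt0.
have Bern L : 1 + L%:R * s <= (1 + s) ^+ L.
  elim: L => [|L IH]; first by rewrite mul0r addr0 expr0.
  rewrite exprS; apply: le_trans (_ : (1 + s) * (1 + L%:R * s) <= _).
    by have : 0 <= L%:R :> R by []; rewrite -natr1; nra.
  by rewrite ler_wpM2l // addr_ge0 // ltW.
(* Bernoulli's inequality alone gives only linear growth, so it is squared: at exponent [2 L] the
   lower bound [(1 + L s)^2] is quadratic in [L], and this [L] makes [L^2 s^2] exceed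
   [2 n L + 1]. *)
pose L := (Num.truncn ((2 * n + 1)%:R / s ^+ 2)).+1.
have HL : (2 * n + 1)%:R < L%:R * s ^+ 2.
  by rewrite -ltr_pdivrMr ?exprn_gt0 // truncnS_gt.
have := Hs (L * 2)%N; rewrite exprM => HL2.
have : (1 + L%:R * s) ^+ 2 <= ((1 + s) ^+ L) ^+ 2.
  by rewrite lerXn2r ?Bern // nnegrE ?exprn_ge0 // addr_ge0 ?mulr_ge0 // ltW.
move=> /le_trans/(_ HL2); move: HL; rewrite !natrD !natrM.
have : 1 <= L%:R :> R by rewrite ler1n.
by have : 0 <= n%:R :> R by []; nra.
Qed.

Section Modulus2.
Variable R : realType.
Implicit Types (z w : R[i]) (p : {poly R[i]}).

Lemma geometric_sum_le (x : R) N :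
  0 <= x -> \sum_(j < N.+1) x ^+ j <= N.+1%:R * Num.max 1 x ^+ N.
Proof.
move=> x0; rewrite mulr_natl -[N.+1 in leRHS]card_ord -sumr_const.
apply: ler_sum => j _; have m1 : 1 <= Num.max 1 x by rewrite le_max lexx.
apply: le_trans (_ : Num.max 1 x ^+ j <= _); last first.
  by rewrite ler_weXn2l // -ltnS.
by rewrite lerXn2r ?nnegrE // le_max ?lexx ?orbT // ler01.
Qed.

(* The extra factor comes from the crude bound on the interpolation kernel;
   it disappears when the estimate is applied to powers of a polynomial. *)
Lemma horner_le_crude p N (r M : R) z :
  0 < r -> (size p <= N.+1)%N ->
  (forall w, normc w = r -> normc p.[w] <= M) ->
  normc p.[z] <= N.+1%:R * Num.max 1 (normc z / r) ^+ N * M.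
Proof.
move=> r0 sp HM; have pz := @omega_prim R N.+1 isT.
pose rc : R[i] := (r%:C)%C.
have nrc : normc rc = r by rewrite normc_real gtr0_norm.
have rc0 : rc != 0.
  apply/eqP => h; move: nrc.
  by rewrite h ComplexField.Normc.normc0 => /eqP; rewrite lt_eqF.
have := unity_roots_interpolation _ _ _ pz _ rc z sp rc0.
move=> /(congr1 (@ComplexField.Normc.normc R)).
rewrite ComplexField.Normc.normcM normc_nat => E.
have N0 : 0 < N.+1%:R :> R by rewrite ltr0n.
rewrite -(ler_pM2r N0) E; apply: le_trans (normc_sum _ _ _ _ _) _.
rewrite [leRHS]mulr_natr -[X in _ *+ X]card_ord -sumr_const.
apply: ler_sum => k _.
have nk : normc (rc * omega R N.+1 ^+ k) = r.
  by rewrite ComplexField.Normc.normcM normc_omegaX mulr1.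
rewrite ComplexField.Normc.normcM [leRHS]mulrC.
apply: ler_pM; rewrite ?normc_ge0 ?HM //.
apply: le_trans (normc_sum _ _ _ _ _) _.
under eq_bigr do rewrite normcX ComplexField.Normc.normcM ComplexField.Normc.normcV nk.
by apply: geometric_sum_le; rewrite divr_ge0 ?normc_ge0 ?ltW.
Qed.

(* For [normc z <= r] this is the maximum modulus principle, for larger [z]
   it is the Bernstein-Walsh inequality. *)
Lemma horner_le_circle p n (r M : R) z :
  0 < r -> (size p <= n.+1)%N ->
  (forall w, normc w = r -> normc p.[w] <= M) ->
  normc p.[z] <= Num.max 1 (normc z / r) ^+ n * M.
Proof.
move=> r0 sp HM.
have M0 : 0 <= M.
  apply: le_trans (HM (r%:C)%C _); first exact: normc_ge0.
  by rewrite normc_real gtr0_norm.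
have m0 : 0 <= Num.max 1 (normc z / r) by rewrite le_max ler01.
apply: (@ler_of_expr_le_linear _ n); rewrite ?mulr_ge0 ?exprn_ge0 ?normc_ge0 //.
move=> L; rewrite -normcX -horner_exp.
have := @horner_le_crude (p ^+ L) (n * L) r (M ^+ L) z r0.
rewrite exprMn -exprM addn1 mulrA; apply.
- apply: leq_trans (size_poly_exp_leq _ _) _; rewrite ltnS leq_mul2r.
  by apply/orP; right; lia.
- move=> w wr; rewrite horner_exp normcX lerXn2r ?nnegrE ?normc_ge0 //.
  exact: HM.
Qed.

(* Reflecting the factors with [normc a <= 1] in the unit circle preserves the
   modulus on the circle, and the value at 0 is then the left-hand side. *)
Lemma mahler_le_unity_root (s : seq R[i]) : exists K k : nat,
  [/\ (0 < K)%N, (k < K)%N &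
  \prod_(a <- s) Num.max 1 (normc a) <=
  \prod_(a <- s) normc (a - omega R K ^+ k)].
Proof.
pose b a : {poly R[i]} :=
  if normc a <= 1 then 1 - (a^*%C) *: 'X else a%:P - 'X.
pose f := \prod_(a <- s) b a.
have f0 : normc f.[0] = \prod_(a <- s) Num.max 1 (normc a).
  rewrite horner_prod normc_prod; apply: eq_bigr => a _; rewrite /b.
  case: ifPn => [|]; rewrite !hornerE ?mulr0 ?subr0.
    by move=> h; rewrite max_l // ComplexField.Normc.normc1.
  by rewrite -ltNge => h; rewrite max_r // ltW.
have f1 z : normc z = 1 -> normc f.[z] = \prod_(a <- s) normc (a - z).
  move=> z1; rewrite horner_prod normc_prod; apply: eq_bigr => a _; rewrite /b.
  case: ifPn => h; rewrite !hornerE //.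
  (* On the unit circle [1 - conj(a) z] is [z] times the conjugate of [z - a]. *)
  have zz : z * z^*%C = 1.
    rewrite -sqr_normc normc_def; move: z1.
    by case: (z) => ? ?; rewrite /normc => ->; rewrite expr1n.
  rewrite -[LHS]normc_conjc rmorphB rmorph1 rmorphM /= conjcK.
  rewrite -[LHS]mul1r -z1 -ComplexField.Normc.normcM mulrBr mulr1 mulrCA zz mulr1.
  exact: normcBC.
(* The degree of [f] is less than [K], so the mean of [f] over the [K]-th roots of unity is exactly
   [f.[0]], and some value there is at least as large in modulus. *)
pose K := (size s).+1.
have sf : (size f <= K)%N.
  have sb a : (size (b a) <= 2)%N.
    rewrite /b; case: ifP => _; apply: leq_trans (size_polyD _ _) _.
      rewrite size_polyN size_poly1 geq_max /=.
      by apply: leq_trans (size_scale_leq _ _) _; rewrite size_polyX.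
    by rewrite size_polyN size_polyX geq_max size_polyC; case: eqP.
  rewrite /f /K; elim: (s) => [|a t IH]; first by rewrite big_nil size_poly1.
  rewrite big_cons; apply: leq_trans (size_polyMleq _ _) _.
  by move: IH (sb a) => /=; move: (size _) (size (b a)) (size t) => i j k; lia.
have pz := @omega_prim R K isT.
have := unity_roots_mean_value _ _ _ pz _ sf.
move=> /(congr1 (@ComplexField.Normc.normc R)).
rewrite ComplexField.Normc.normcM normc_nat => E.
have [k Hk] : exists k : 'I_K, normc f.[0] <= normc f.[omega R K ^+ k].
  apply/existsP; rewrite -[X in is_true X]negbK; apply/negP.
  rewrite negb_exists => /forallP H.
  have : normc f.[0] * K%:R < normc f.[0] * K%:R.
    rewrite {1}E; apply: le_lt_trans (normc_sum _ _ _ _ _) _.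
    rewrite mulr_natr -[X in _ *+ X]card_ord -sumr_const.
    apply: ltr_sum; first by apply/hasP; exists ord0; rewrite // mem_index_enum.
    by move=> k _; rewrite ltNge.
  by rewrite ltxx.
exists K, k; split=> //; rewrite -f0 -f1 //; exact: normc_omegaX.
Qed.

End Modulus2.

(** * Products of chord lengths *)

Section ChordProduct.
Variable R : realType.
Implicit Types r x : R.

(** For [x] in [0, pi], the distance from [- r] to [r e^(ix)], truncated below at 1. *)
Definition chord r x := Num.max 1 (2 * r * cos (x / 2)).

(** Its logarithm is a left-endpoint Riemann sum on [0, pi], up to the factor [pi / m]. *)
Definition chord_prod r m := \prod_(l < m) chord r (l%:R * (pi / m%:R)).

Lemma chord_ge1 r x : 1 <= chord r x.
Proof. by rewrite le_max lexx. Qed.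

Lemma chord_prod_ge1 r m : 1 <= chord_prod r m.
Proof.
rewrite /chord_prod; elim/big_rec: _ => // i x _ x1.
by apply: mulr_ege1 => //; exact: chord_ge1.
Qed.

Lemma le_chord r x y : 0 <= r -> 0 <= x -> x <= y -> y <= pi ->
  chord r y <= chord r x.
Proof.
move=> r0 x0 xy ypi; have p0 := pi_gt0 R; rewrite /chord.
have H : cos (y / 2) <= cos (x / 2).
  move: xy; rewrite le_eqVlt => /predU1P[->//|xy].
  by apply/ltW; rewrite ltr_cos ?in_itv /=; lra.
rewrite ge_max !le_max lexx /=; apply/orP; right.
by rewrite ler_wpM2l // mulr_ge0.
Qed.

Lemma chordE r x : 0 <= x <= pi -> Num.max 1 (r * normc (1 + expi x)) = chord r x.
Proof.
move=> /andP[x0 xpi]; rewrite normc_1Dexpi ger0_norm.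
  by rewrite mulrCA mulrA.
by apply: cos_ge0_pihalf; lra.
Qed.

Lemma chord_reflect r x : pi <= x <= 2 * pi ->
  Num.max 1 (r * normc (1 + expi x)) = chord r (2 * pi - x).
Proof.
move=> /andP[x0 xpi]; have p0 := pi_gt0 R.
rewrite -chordE; last by apply/andP; split; lra.
rewrite !normc_1Dexpi; have -> : (2 * pi - x) / 2 = pi - x / 2 by field.
by rewrite cosB cospi sinpi mul0r addr0 mulN1r normrN.
Qed.

(** The [2 m] equally spaced angles, shifted by at most one step, split into [m] on the upper half
    circle and [m] on the lower. After reflecting the latter, each angle is at least its own grid
    point [l pi / m], and [chord] decreases. *)
Lemma prod_arc_le r m (beta : R) : 0 <= r -> (0 < m)%N ->
  0 <= beta <= pi / m%:R ->
  \prod_(j < m + m) Num.max 1 (r * normc (1 + expi beta * omega R (m + m) ^+ j))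
  <= chord_prod r m ^+ 2.
Proof.
move=> r0 m0 /andP[b0 b1]; have p0 := pi_gt0 R.
have mR : 0 < m%:R :> R by rewrite ltr0n.
pose h : R := pi / m%:R.
have h0 : 0 < h by rewrite divr_gt0.
have mh : m%:R * h = pi by rewrite mulrC divfK // gt_eqF.
have E j : expi beta * omega R (m + m) ^+ j = expi (beta + j%:R * h).
  rewrite expiX -expiD /h natrD; congr (expi (_ + _ * _)).
  by field; rewrite !gt_eqF ?addr_gt0.
have bh : beta <= h := b1.
have jm (j : 'I_m) : j%:R * h + h <= pi.
  by rewrite -mh -[X in _ + X]mul1r -mulrDl ler_pM2r // natr1 ler_nat.
have j0 (j : 'I_m) : 0 <= j%:R * h by rewrite mulr_ge0 // ltW.
under eq_bigr do rewrite E.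
have p1 k : 0 <= \prod_(i < m) chord r (k i).
  by apply: prodr_ge0 => i _; apply: le_trans (chord_ge1 _ _).
rewrite big_split_ord /= expr2; apply: ler_pM.
- by apply: prodr_ge0 => i _; rewrite le_max ler01.
- by apply: prodr_ge0 => i _; rewrite le_max ler01.
- apply: ler_prod => i _; rewrite le_max ler01 /=.
  have := jm i; have := j0 i => ? ?.
  rewrite chordE; last by apply/andP; split; lra.
  by apply: le_chord => //; rewrite -?/h; lra.
(* Read backwards, the lower angles reflect to [(i + 1) h - beta], which is at least [i h] since
   [beta <= h]. *)
- rewrite /chord_prod (reindex_inj rev_ord_inj) /=.
  apply: ler_prod => i _; rewrite le_max ler01 /=.
  have := jm i; have := j0 i => ? ?.
  have -> : (m + (m - i.+1))%:R * h = 2 * pi - (i%:R * h + h).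
    by rewrite natrD natrB // -natr1 !(mulrDl, mulrBl) mulNr mul1r mh; ring.
  rewrite chord_reflect; last by apply/andP; split; lra.
  by apply: le_chord => //; rewrite -?/h; lra.
Qed.

Lemma max1_exp (x : R) n : 0 <= x -> Num.max 1 (x ^+ n) = Num.max 1 x ^+ n.
Proof.
move=> x0; case: (leP 1 x) => h.
  by apply: max_r; rewrite exprn_ege1.
by rewrite expr1n; apply: max_l; rewrite exprn_ile1 // ltW.
Qed.

(** Discrete form of the mean of [log max(1, |v| / r)] over the unit circle around [u]. The factor
    [2 ^+ (m + m)] is the discretization error; it becomes negligible after taking a root of order
    [N * (m + m)] with [N] large. *)
Lemma unit_circle_prod_le r (u : R[i]) (N m : nat) (theta : R) :
  0 < r -> normc u = r -> (0 < N)%N -> (0 < m)%N ->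
  (\prod_(l < N) Num.max 1 (normc (u - expi theta * omega R N ^+ l) / r))
    ^+ (m + m) * r ^+ (N * (m + m))
  <= 2 ^+ (m + m) * chord_prod r m ^+ (2 * N).
Proof.
move=> r0 ur N0 m0; set Q := (m + m)%N.
have Q0 : (0 < Q)%N by rewrite /Q addn_gt0 m0.
have rn0 : r != 0 by rewrite gt_eqF.
have u0 : u != 0.
  apply/eqP => h; move: ur.
  by rewrite h ComplexField.Normc.normc0 => /eqP; rewrite lt_eqF.
have pQ := @omega_prim R Q Q0; have pN := @omega_prim R N N0.
pose v l := u - expi theta * omega R N ^+ l.
(* Dividing by [- u] rather than [u] makes the chord factor [1 + xi] appear below. *)
have [K [k [K0 kK]]] :=
  mahler_le_unity_root R [seq (v (nat_of_ord l) / - u) ^+ Q | l <- index_enum 'I_N].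
rewrite !big_map => H.
have nv l : normc (v l / - u) = normc (v l) / r.
  by rewrite ComplexField.Normc.normcM ComplexField.Normc.normcV normcN ur.
(* A [Q]-th root of [omega R K ^+ k] has this argument; [k < K] keeps it within one step
   [pi / m]. *)
pose beta : R := 2 * pi * k%:R / (K * Q)%:R.
have KR : 0 < K%:R :> R by rewrite ltr0n.
have QR : 0 < Q%:R :> R by rewrite ltr0n.
have mR : 0 < m%:R :> R by rewrite ltr0n.
have p0 := pi_gt0 R.
have bQ : expi beta ^+ Q = omega R K ^+ k.
  rewrite !expiX /beta natrM; congr (expi _); field.
  by rewrite !gt_eqF ?addr_gt0.
have bb : 0 <= beta <= pi / m%:R.
  apply/andP; split; first by rewrite divr_ge0 ?mulr_ge0 // ltW.
  have -> : beta = (k%:R / K%:R) * (pi / m%:R).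
    rewrite /beta /Q natrM natrD; field.
    by rewrite !gt_eqF ?addr_gt0.
  rewrite ger_pMl ?divr_gt0 // ler_pdivrMr // mul1r ler_nat; exact: ltnW.
rewrite -prodrXl.
under eq_bigr => l _.
  rewrite -nv -max1_exp ?normc_ge0 // -normcX.
  over.
have -> : r ^+ (N * Q) = \prod_(l < N) r ^+ Q.
  by rewrite prodr_const card_ord -exprM mulnC.
apply: le_trans (_ : \prod_(l < N) normc ((v l / - u) ^+ Q - omega R K ^+ k)
   * \prod_(l < N) r ^+ Q <= _).
  by rewrite ler_wpM2r // prodr_ge0 // => i _; rewrite exprn_ge0 // ltW.
rewrite -big_split /=.
under eq_bigr => l _.
  rewrite -bQ -(prod_sub_unity_roots _ _ _ pQ) normc_prod.
  have -> : r ^+ Q = \prod_(j < Q) r by rewrite prodr_const card_ord.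
  rewrite -big_split /=.
  over.
(* For fixed [j] the product over [l] now runs over the [N]-th roots of unity and collapses to a
   difference of two [N]-th powers, at most [2 max(1, r |1 + xi|)^N] in modulus. *)
rewrite exchange_big /=.
have -> : 2 ^+ Q * chord_prod r m ^+ (2 * N) =
   2 ^+ Q * (chord_prod r m ^+ 2) ^+ N by rewrite exprM.
have c0 : 0 <= chord_prod r m ^+ 2.
  by rewrite exprn_ge0 // (le_trans _ (chord_prod_ge1 _ _)).
apply: le_trans (_ : 2 ^+ Q * (\prod_(j < Q)
   Num.max 1 (r * normc (1 + expi beta * omega R Q ^+ j))) ^+ N <= _); last first.
  rewrite ler_wpM2l ?exprn_ge0 // lerXn2r ?nnegrE //; last first.
    by apply: prod_arc_le => //; exact: ltW.
  by apply: prodr_ge0 => i _; rewrite le_max ler01.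
have -> : 2 ^+ Q = \prod_(j < Q) (2 : R) by rewrite prodr_const card_ord.
rewrite -prodrXl -big_split /=.
apply: ler_prod => j _; rewrite prodr_ge0 /=; last first.
  by move=> i _; rewrite mulr_ge0 ?normc_ge0 // ltW.
set xi := expi beta * _.
under eq_bigr => l _.
  have -> : normc (v l / - u - xi) * r =
      normc (u * (1 + xi) - expi theta * omega R N ^+ l).
    rewrite -ur -ComplexField.Normc.normcM mulrBl -(normcN (_ - _)); congr normc.
    by rewrite /v; field.

  over.
rewrite -normc_prod (prod_sub_unity_roots _ _ _ pN).
apply: le_trans (le_normcD _ _) _.
rewrite normcN normcX ComplexField.Normc.normcM ur normcX normc_expi expr1n.
have w0 : 0 <= r * normc (1 + xi) by rewrite mulr_ge0 ?normc_ge0 // ltW.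
have W1 : (r * normc (1 + xi)) ^+ N <= Num.max 1 (r * normc (1 + xi)) ^+ N.
  by rewrite lerXn2r ?nnegrE ?le_max ?lexx ?orbT ?ler01.
have W2 : 1 <= Num.max 1 (r * normc (1 + xi)) ^+ N.
  by rewrite exprn_ege1 // le_max lexx.
by rewrite mulr_natl mulr2n lerD.
Qed.

(** Discrete Jensen on the unit circle around [u] bounds the left product by values of the
    polynomial there, and [unit_circle_prod_le] then handles the growth of these values off the
    disk. *)
Lemma root_prod_le (s : seq R[i]) r (M : R) (u : R[i]) (N m : nat) :
  0 < r -> normc u = r -> (0 < N)%N -> (0 < m)%N ->
  (forall w, normc w = r -> normc (\prod_(a <- s) ('X - a%:P)).[w] <= M) ->
  (\prod_(a <- s) Num.max 1 (normc (u - a))) ^+ (N * (m + m))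
    * (r ^+ (N * (m + m))) ^+ size s
  <= M ^+ (N * (m + m))
     * (2 ^+ (m + m) * chord_prod r m ^+ (2 * N)) ^+ size s.
Proof.
move=> r0 ur N0 m0 HM; set p := \prod_(a <- s) _ in HM *.
have pN := @omega_prim R N N0.
have M0 : 0 <= M.
  by apply: le_trans (HM u ur); exact: normc_ge0.
have [K [k [K0 kK]]] := mahler_le_unity_root R [seq (u - a) ^+ N | a <- s].
rewrite !big_map => H.
pose theta : R := 2 * pi * k%:R / (K * N)%:R.
have NR : 0 < N%:R :> R by rewrite ltr0n.
have KR : 0 < K%:R :> R by rewrite ltr0n.
have tN : expi theta ^+ N = omega R K ^+ k.
  rewrite !expiX /theta natrM; congr (expi _); field.
  by rewrite !gt_eqF ?addr_gt0.
have {}H : (\prod_(a <- s) Num.max 1 (normc (u - a))) ^+ N <=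
    \prod_(l < N) normc p.[u - expi theta * omega R N ^+ l].
  rewrite -prodrXl; under eq_bigr do rewrite -max1_exp ?normc_ge0 // -normcX.
  apply: (le_trans H); rewrite le_eqVlt; apply/orP; left; apply/eqP.
  under eq_bigr do rewrite -tN -(prod_sub_unity_roots _ _ _ pN) normc_prod.
  rewrite exchange_big /=; apply: eq_bigr => l _.
  rewrite /p horner_prod normc_prod; apply: eq_bigr => a _.
  by rewrite !hornerE addrAC.
have sp : (size p <= (size s).+1)%N by rewrite size_prod_XsubC.
pose B := \prod_(l < N) Num.max 1 (normc (u - expi theta * omega R N ^+ l) / r).
(* Each of the [N] values is at most [M max(1, |v| / r)^n] with [n = size s], by Bernstein-Walsh. *)
have {}H : (\prod_(a <- s) Num.max 1 (normc (u - a))) ^+ N <= B ^+ size s * M ^+ N.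
  apply: (le_trans H).
  have -> : M ^+ N = \prod_(l < N) M by rewrite prodr_const card_ord.
  rewrite /B -prodrXl -big_split /=; apply: ler_prod => l _.
  by rewrite normc_ge0 /=; apply: horner_le_circle.
have A0 : 0 <= \prod_(a <- s) Num.max 1 (normc (u - a)).
  by apply: prodr_ge0 => a _; rewrite le_max ler01.
have B0 : 0 <= B by apply: prodr_ge0 => a _; rewrite le_max ler01.
rewrite !(exprM _ N (m + m)).
apply: le_trans (_ : (B ^+ size s * M ^+ N) ^+ (m + m) *
   ((r ^+ N) ^+ (m + m)) ^+ size s <= _).
  rewrite ler_wpM2r ?exprn_ge0 ?(ltW r0) //.
  by rewrite lerXn2r ?nnegrE ?mulr_ge0 ?exprn_ge0.
rewrite exprMn [X in X * _]mulrC -mulrA ler_wpM2l ?exprn_ge0 //.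
have -> : (B ^+ size s) ^+ (m + m) * ((r ^+ N) ^+ (m + m)) ^+ size s =
   (B ^+ (m + m) * r ^+ (N * (m + m))) ^+ size s.
  by rewrite exprMn -!exprM (mulnC (size s)) mulnA.
rewrite lerXn2r ?nnegrE ?mulr_ge0 ?exprn_ge0 ?(ltW r0) //.
- by rewrite (le_trans _ (chord_prod_ge1 _ _)).
- exact: unit_circle_prod_le.
Qed.

End ChordProduct.

Arguments chord {R} r x.
Arguments chord_prod {R} r m.

(** * Riemann sums *)

Section RiemannSums.
Variable R : realType.
Variable f : R -> R.
Hypothesis cf : continuous f.
Local Notation mu := (@lebesgue_measure R).

Lemma continuous_integrable_itv (a b : R) :
  mu.-integrable `[a, b] (EFin \o f).
Proof.
apply: continuous_compact_integrable; first exact: segment_compact.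
exact: continuous_subspaceT.
Qed.

Lemma Rintegral_itv_chasles (a b c : R) : a <= b -> b <= c ->
  \int[mu]_(x in `[a, c]) f x =
  \int[mu]_(x in `[a, b]) f x + \int[mu]_(x in `[b, c]) f x.
Proof.
move=> ab bc; apply/eqP; rewrite addrC -subr_eq; apply/eqP.
rewrite Rintegral_itvB ?bnd_simp //; last exact: continuous_integrable_itv.
rewrite Rintegral_itv_obnd_cbnd //.
apply: integrableS (continuous_integrable_itv a c) => //.
by apply: subset_itvr; rewrite bnd_simp.
Qed.

Lemma Rintegral_itv_cst (a b r : R) : a <= b ->
  \int[mu]_(x in `[a, b]) r = (b - a) * r.
Proof.
move=> ab; rewrite Rintegral_cst //= lebesgue_measure_itv /= lte_fin mulrC.
by case: ltgtP ab => //= -> _; rewrite subrr.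
Qed.

Lemma integrable_itv_cst (a b r : R) : mu.-integrable `[a, b] (EFin \o cst r).
Proof.
apply: continuous_compact_integrable; first exact: segment_compact.
by apply: continuous_subspaceT => x; exact: cvg_cst.
Qed.

Lemma antitone_Rintegral_bounds (a b : R) : a <= b ->
  (forall x, a <= x <= b -> f b <= f x <= f a) ->
  (b - a) * f b <= \int[mu]_(x in `[a, b]) f x <= (b - a) * f a.
Proof.
move=> ab H; rewrite -!(Rintegral_itv_cst _ _ _ ab); apply/andP; split.
- apply: le_Rintegral => //.
  + exact: integrable_itv_cst.
  + exact: continuous_integrable_itv.
  + by move=> x /=; rewrite in_itv => /H/andP[].
- apply: le_Rintegral => //.
  + exact: continuous_integrable_itv.
  + exact: integrable_itv_cst.
  + by move=> x /=; rewrite in_itv => /H/andP[].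
Qed.

Lemma antitone_Riemann_sum_bounds (h : R) (m : nat) : 0 <= h ->
  (forall x y, 0 <= x -> x <= y -> y <= m%:R * h -> f y <= f x) ->
  h * \sum_(l < m) f (l.+1%:R * h) <= \int[mu]_(x in `[0, m%:R * h]) f x
    <= h * \sum_(l < m) f (l%:R * h).
Proof.
move=> h0; elim: m => [|m IH] mono.
  rewrite mul0r !big_ord0 mulr0.
  by rewrite set_itv1 Rintegral_set1 lexx.
have mh : 0 <= m%:R * h by rewrite mulr_ge0.
have le1 : m%:R * h <= m.+1%:R * h by rewrite ler_wpM2r // ler_nat.
have /andP[IH1 IH2] := IH (fun x y x0 xy ym => mono x y x0 xy (le_trans ym le1)).
have := @antitone_Rintegral_bounds _ _ le1.
have -> : m.+1%:R * h - m%:R * h = h by rewrite -natr1; ring.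
case/(_ _)/andP => [x /andP[x1 x2]|B1 B2].
  by rewrite !mono // (le_trans mh).
rewrite (Rintegral_itv_chasles _ _ _ mh le1) !big_ord_recr /= !mulrDr.
by rewrite !lerD.
Qed.

End RiemannSums.

(** * The integral of the logarithm of the truncated chord *)

Section ChordIntegral.
Variable R : realType.
Implicit Types r : R.
Local Notation mu := (@lebesgue_measure R).

Lemma continuous_ln_chord r : continuous (fun x => ln (chord r x)).
Proof.
move=> x; apply: (@continuous_comp _ _ _ (chord r) (@ln R)); last first.
  by apply: continuous_ln; exact: lt_le_trans ltr01 (chord_ge1 _ _ _).
apply: (@continuous_max _ _ (cst 1) (fun x : R => 2 * r * cos (x / 2))).
  exact: cvg_cst.
apply: continuousM; first exact: cvg_cst.
apply: (@continuous_comp _ _ _ (fun x : R => x / 2) (@cos R)).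
  by apply: continuousM; [exact: cvg_id|exact: cvg_cst].
exact: continuous_cos.
Qed.

Lemma ln_chord_prod r m :
  ln (chord_prod r m) = \sum_(l < m) ln (chord r (l%:R * (pi / m%:R))).
Proof.
rewrite /chord_prod.
(* Positivity is carried along because [ln] is multiplicative only on positive factors. *)
pose K (x y : R) := 0 < x /\ ln x = y.
suff [] : K (\prod_(l < m) chord r (l%:R * (pi / m%:R)))
  (\sum_(l < m) ln (chord r (l%:R * (pi / m%:R)))) by [].
apply: (big_ind2 K); first by rewrite /K ln1.
  by move=> a b c d [a0 <-] [c0 <-]; split; rewrite ?mulr_gt0 // lnM.
by move=> i _; split=> //; exact: lt_le_trans ltr01 (chord_ge1 _ _ _).
Qed.

Lemma chord_pi r : chord r pi = 1.
Proof. by rewrite /chord cos_pihalf mulr0 max_l. Qed.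

(** The left and right Riemann sums of a decreasing function enclose its integral; unscaled, they
    differ by the two end values, of which [ln (chord r pi)] is 0. *)
Lemma ln_chord_prod_bounds r m (J := \int[mu]_(x in `[0, pi]) ln (chord r x)) :
  0 <= r -> (0 < m)%N ->
  m%:R * (1 / pi * J) <= ln (chord_prod r m)
    <= m%:R * (1 / pi * J) + ln (chord r 0).
Proof.
move=> r0 m0; have p0 := pi_gt0 R.
have mR : 0 < m%:R :> R by rewrite ltr0n.
pose h : R := pi / m%:R.
have h0 : 0 < h by rewrite divr_gt0.
have mh : m%:R * h = pi by rewrite mulrC divfK // gt_eqF.
have := @antitone_Riemann_sum_bounds R _ (continuous_ln_chord r) h m (ltW h0).
rewrite mh => /(_ _)/andP[].
  move=> x y x0 xy yp.
  by rewrite ler_ln ?posrE ?(lt_le_trans ltr01 (chord_ge1 _ _ _)) // le_chord.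
rewrite -ln_chord_prod -/J => H1 H2.
have E : \sum_(l < m) ln (chord r (l.+1%:R * h)) + ln (chord r 0) =
    ln (chord_prod r m).
  have : \sum_(l < m.+1) ln (chord r (l%:R * h)) = ln (chord_prod r m).
    by rewrite big_ord_recr /= mh chord_pi ln1 addr0 ln_chord_prod.
  by rewrite big_ord_recl mul0r => <-; rewrite addrC.
have {}H1 : h * (ln (chord_prod r m) - ln (chord r 0)) <= J.
  by rewrite -E addrK.
have -> : m%:R * (1 / pi * J) = J / h.
  by rewrite /h invf_div mul1r; ring.
rewrite ler_pdivrMr // [_ * h]mulrC H2 /=.
by rewrite -lerBlDr ler_pdivlMr // mulrC.
Qed.

Lemma ln_chord_small r x : 0 <= r -> r <= 1 / 2 -> ln (chord r x) = 0.
Proof.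
move=> r0 r1; rewrite /chord max_l ?ln1 //.
have := cos_le1 (x / 2); have := cos_geN1 (x / 2); nra.
Qed.

(** The upper limit is the angle where [2 r cos(x/2)] falls to 1; beyond it the truncation makes the
    integrand 0. *)
Lemma Rintegral_ln_chord r : 1 / 2 < r ->
  \int[mu]_(x in `[0, pi]) ln (chord r x) =
  \int[mu]_(x in `[0, pi - 2 * asin (1 / (2 * r))]) ln (2 * r * cos (x / 2)).
Proof.
move=> r1; have p0 := pi_gt0 R.
set c := 1 / (2 * r); set x0 := pi - _.
have r2 : 1 < 2 * r by lra.
have c0 : 0 < c by rewrite divr_gt0 //; lra.
have c1 : c < 1 by rewrite /c ltr_pdivrMr ?mul1r //; lra.
have cc : -1 <= c <= 1 by apply/andP; split; lra.
have a0 : 0 < asin c.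
  rewrite ltNge; apply/negP => h.
  have : sin (asin c) = c by rewrite asinK // in_itv.
  have := asin_geNpi2 cc => h2.
  have := @sin_ge0_pi R (- asin c); rewrite sinN.
  by case/(_ _)/Wrap => [|]; [apply/andP; split|]; lra.
have a1 := asin_lepi2 cc.
have cx0 : cos (x0 / 2) = c.
  have -> : x0 / 2 = - asin c + pi / 2 by rewrite /x0; field.
  by rewrite cosDpihalf sinN opprK asinK // in_itv.
have rc : 2 * r * c = 1 by rewrite /c; field; lra.
have x00 : 0 <= x0 by rewrite /x0; lra.
have x0p : x0 <= pi by rewrite /x0; lra.
have mono (x y : R) : 0 <= x -> x <= y -> y <= pi -> cos (y / 2) <= cos (x / 2).
  move=> hx; rewrite le_eqVlt => /predU1P[->//|xy] yp.
  by apply/ltW; rewrite ltr_cos ?in_itv /=; lra.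
rewrite (Rintegral_itv_chasles _ _ (continuous_ln_chord r) _ _ _ x00 x0p).
rewrite [X in _ + X](_ : _ = 0) ?addr0.
  apply: eq_Rintegral => x /[!inE] /=; rewrite in_itv /= => /andP[xa xb].
  have H : cos (x0 / 2) <= cos (x / 2) by apply: mono; lra.
  rewrite /chord max_r // -[leLHS]rc ler_wpM2l -?cx0 //; lra.
rewrite [LHS](@eq_Rintegral _ _ _ _ _ (cst 0)).
  by rewrite (Rintegral_itv_cst _ _ _ _ x0p) mulr0.
move=> x /[!inE] /=; rewrite in_itv /= => /andP[xa xb].
have H : cos (x / 2) <= cos (x0 / 2) by apply: mono; lra.
by rewrite /chord max_l ?ln1 // -[leRHS]rc ler_wpM2l -?cx0 //; lra.
Qed.

End ChordIntegral.

(** * The closed disk *)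

Section ClosedDisk.
Variables (R : realType) (r : R).
Hypothesis r0 : 0 < r.
Implicit Types (z : R[i]) (p : {poly R[i]}).

Lemma norm_normc z : `|z| = ((normc z)%:C)%C.
Proof. by []. Qed.

Lemma closed_diskP z : closed_disk r z <-> normc z <= r.
Proof.
pose z' : (R[i] : numFieldType) := z.
split=> [zcl|zr].
  rewrite leNgt; apply/negP => rz.
  have e0 : 0 < ((normc z - r)%:C)%C :> R[i] by rewrite ltcR subr_gt0.
  have [w [/= wr]] := zcl _ (nbhsx_ballx z' _ e0).
  rewrite -ball_normE /= norm_normc ltcR => zw.
  have := le_normcD (z - w) w; rewrite subrK.
  have {}wr : normc w < r := wr.
  have {}zw : normc (z - w) < normc z - r := zw.
  lra.
move=> B /nbhs_ballP[e /= e0 eB].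
(* Positive elements of [R[i]] are real, so the radius of the ball comes from [R]. *)
have [d d0 de] : exists2 d : R, 0 < d & e = (d%:C)%C.
  by case: e e0 {eB} => a b; rewrite ltcE /= => /andP[/eqP -> a0]; exists a.
(* Shrinking [z] by the factor [1 - t] moves it by at most [t r < d] and puts it in the open
   disk. *)
pose t := d / (r + d).
have rd : 0 < r + d by rewrite addr_gt0.
have t0 : 0 < t by rewrite divr_gt0.
have t1 : t < 1 by rewrite /t ltr_pdivrMr // mul1r ltrDr.
have td : t * r < d.
  by rewrite /t mulrAC ltr_pdivrMr // ltr_pM2l // ltrDl.
exists (((1 - t)%:C)%C * z); split.
  rewrite /open_disk /= ComplexField.Normc.normcM normc_real ger0_norm ?subr_ge0 ?ltW //.
  apply: le_lt_trans (_ : (1 - t) * r < r); first by rewrite ler_wpM2l // subr_ge0 ltW.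
  by rewrite gtr_pMl // gtrBl.
apply: eB; rewrite -ball_normE /= de norm_normc ltcR.
have -> : z - ((1 - t)%:C)%C * z = (t%:C)%C * z.
  by rewrite rmorphB rmorph1; ring.
rewrite ComplexField.Normc.normcM normc_real gtr0_norm //.
by apply: le_lt_trans td; rewrite ler_pM2l.
Qed.

Lemma le_sup_norm p z : normc z <= r -> normc p.[z] <= sup_norm (closed_disk r) p.
Proof.
move=> zr; apply: ub_le_sup; last by exists z => //; apply/closed_diskP.
(* An explicit upper bound ensures that [sup] is not the default value 0. *)
exists (\sum_(i < size p) normc p`_i * r ^+ i) => _ [w /closed_diskP wr <-].
rewrite horner_coef; apply: le_trans (normc_sum _ _ _ _ _) _.
apply: ler_sum => i _; rewrite ComplexField.Normc.normcM normcX.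
rewrite ler_wpM2l ?normc_ge0 // lerXn2r ?nnegrE ?normc_ge0 //; exact: ltW.
Qed.

Lemma sup_norm_le p (B : R) :
  (forall z, normc z <= r -> normc p.[z] <= B) -> sup_norm (closed_disk r) p <= B.
Proof.
move=> H; apply: ge_sup.
  exists (normc p.[0]); exists 0 => //; apply/closed_diskP.
  by rewrite ComplexField.Normc.normc0 ltW.
by move=> _ [z /closed_diskP zr <-]; exact: H.
Qed.

(** Archimedean limit argument: it discards errors that stay bounded while the main term grows like
    [k]. *)
Lemma ler0_of_mulrn_bounded (x D : R) :
  (forall k, (0 < k)%N -> k%:R * x <= D) -> x <= 0.
Proof.
move=> H; rewrite leNgt; apply/negP => x0.
have := H _ (ltn0Sn (Num.truncn (D / x))).
by rewrite leNgt -ltr_pdivrMr // truncnS_gt.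
Qed.

Lemma ln_expr (x : R) n : 0 < x -> ln (x ^+ n) = n%:R * ln x.
Proof. by move=> x0; rewrite lnXn // mulr_natl. Qed.

Lemma monic_splits p : p \is monic ->
  exists s : seq R[i], p = \prod_(a <- s) ('X - a%:P).
Proof.
move=> /monicP pm; have [s ps] := closed_field_poly_normal p.
by exists s; rewrite ps pm scale1r.
Qed.

(** * The constant is admissible and smallest *)

Variables (J K : R).
(** Both bounds need only that [ln (chord_prod r m)] is [m J] up to a bounded error. *)
Hypothesis ln_chord_prodJ : forall m, (0 < m)%N ->
  m%:R * J <= ln (chord_prod r m) <= m%:R * J + K.

Let C := 1 / r * expR J.

Let C_gt0 : 0 < C.
Proof. by rewrite mulr_gt0 ?divr_gt0 ?expR_gt0. Qed.

Let ln_C : ln C = J - ln r.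
Proof. by rewrite /C mul1r lnM ?posrE ?invr_gt0 ?expR_gt0 // expRK lnV // addrC. Qed.

(** Take [N = m = k] in [root_prod_le], then logarithms, and divide by [2 k]: what remains is [k]
    times the wanted inequality, with error at most [n (ln 2 + K)]. *)
Lemma root_prod_le_sup_norm (s : seq R[i]) u : normc u = r ->
  \prod_(a <- s) Num.max 1 (normc (u - a)) <=
  C ^+ size s * sup_norm (closed_disk r) (\prod_(a <- s) ('X - a%:P)).
Proof.
move=> ur; set A := \prod_(a <- s) Num.max _ _.
set M := sup_norm _ _; pose n := size s.
have HM w : normc w = r -> normc (\prod_(a <- s) ('X - a%:P)).[w] <= M.
  by move=> wr; apply: le_sup_norm; rewrite wr.
have A0 : 0 < A.
  by apply: prodr_gt0 => a _; rewrite lt_max ltr01.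
have H k (k0 : (0 < k)%N) := root_prod_le R s r M u k k r0 ur k0 k0 HM.
(* If [M] were 0, the case [k = 1] would bound a positive product by 0. *)
have M0 : 0 < M.
  have : 0 <= M by apply: le_trans (HM u ur); exact: normc_ge0.
  rewrite le_eqVlt => /predU1P[M0|//].
  have := H 1%N isT; rewrite -M0 expr0n /= mul0r leNgt.
  by rewrite mulr_gt0 ?exprn_gt0.
rewrite -ler_ln ?posrE ?mulr_gt0 ?exprn_gt0 //.
rewrite lnM ?posrE ?exprn_gt0 // ln_expr // ln_C -subr_le0.
apply: (@ler0_of_mulrn_bounded _ (n%:R * (ln 2 + K))) => k k0.
have G0 : 0 < chord_prod r k by apply: lt_le_trans ltr01 (chord_prod_ge1 _ _ _).
have HH := H k k0.
rewrite -ler_ln ?posrE ?mulr_gt0 ?exprn_gt0 ?mulr_gt0 ?exprn_gt0 // in HH.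
rewrite !(lnM, ln_expr) ?posrE ?mulr_gt0 ?exprn_gt0 ?mulr_gt0 ?exprn_gt0 // in HH.
rewrite !natrM !natrD -/n in HH *.
have /andP[_] := ln_chord_prodJ _ k0.
have kR : 0 < k%:R :> R by rewrite ltr0n.
have nR : 0 <= n%:R :> R by [].
set S := ln (chord_prod r k) in HH * => HS.
have nS : n%:R * S <= n%:R * (k%:R * J + K) by rewrite ler_wpM2l.
have : (2 * k%:R) * (k%:R * (ln A + n%:R * ln r)) <=
       (2 * k%:R) * (k%:R * ln M + n%:R * (ln 2 + S)) by move: HH; lra.
by rewrite ler_pM2l ?mulr_gt0 //; lra.
Qed.

(** Roots of the cofactor contribute factors at least 1, so on the circle [|q|] is at most the
    product over all roots of [p]; the maximum principle extends the bound to the disk. *)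
Lemma factor_constant_mem : factor_constants (closed_disk r) C.
Proof.
split=> // p q pm [qm [t pqt]].
have tm : t \is monic by rewrite -(monicMl t qm) -pqt.
have [sq Eq] := monic_splits _ qm; have [st Et] := monic_splits _ tm.
have Ep : p = \prod_(a <- sq ++ st) ('X - a%:P) by rewrite big_cat pqt Eq Et.
have Hu u : normc u = r ->
    normc q.[u] <= C ^+ (size p).-1 * sup_norm (closed_disk r) p.
  move=> ur; rewrite Ep size_prod_XsubC /=.
  apply: le_trans (root_prod_le_sup_norm _ _ ur).
  rewrite Eq horner_prod normc_prod big_cat /= -[leLHS]mulr1.
  apply: ler_pM => //.
  - by apply: prodr_ge0 => a _; exact: normc_ge0.
  - apply: ler_prod => a _; rewrite normc_ge0 !hornerE /=.
    by rewrite le_max lexx orbT.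
  - elim/big_rec: _ => // a x _ x1.
    by apply: mulr_ege1 => //; rewrite le_max lexx.
apply: sup_norm_le => z zr.
have := @horner_le_circle R q (size q) r _ z r0 (leqnSn _) Hu.
rewrite [Num.max _ _]max_l ?expr1n ?mul1r //.
by rewrite ler_pdivrMr // mul1r.
Qed.

(** Unshifted angles give equality. The lower half reflects to [h, ..., pi]: the angle [pi]
    contributes 1, and the extra [chord r 0] supplies the missing angle 0. *)
Lemma prod_half_arc m : (0 < m)%N ->
  \prod_(j < m + m) Num.max 1 (r * normc (1 + omega R (m + m) ^+ j)) * chord r 0
  = chord_prod r m ^+ 2.
Proof.
move=> m0; have p0 := pi_gt0 R.
have mR : 0 < m%:R :> R by rewrite ltr0n.
pose h : R := pi / m%:R.
have h0 : 0 < h by rewrite divr_gt0.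
have mh : m%:R * h = pi by rewrite mulrC divfK // gt_eqF.
have E j : omega R (m + m) ^+ j = expi (j%:R * h).
  rewrite expiX /h natrD; congr (expi (_ * _)).
  by field; rewrite !gt_eqF ?addr_gt0.
have jm (j : 'I_m) : j%:R * h + h <= pi.
  by rewrite -mh -[X in _ + X]mul1r -mulrDl ler_pM2r // natr1 ler_nat.
have j0 (j : 'I_m) : 0 <= j%:R * h by rewrite mulr_ge0 // ltW.
under eq_bigr do rewrite E.
rewrite big_split_ord /= expr2 -mulrA; congr (_ * _).
  apply: eq_bigr => i _; rewrite chordE //.
  by apply/andP; split; have := jm i; have := j0 i; lra.
have -> : chord_prod r m = \prod_(l < m.+1) chord r (l%:R * h).
  by rewrite big_ord_recr /= mh chord_pi mulr1.
rewrite big_ord_recl /= mul0r mulrC; congr (_ * _).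
rewrite (reindex_inj rev_ord_inj) /=; apply: eq_bigr => i _.
have -> : (m + (m - i.+1))%:R * h = 2 * pi - (i%:R * h + h).
  by rewrite natrD natrB // -natr1 !(mulrDl, mulrBl) mulNr mul1r mh; ring.
rewrite chord_reflect; last by apply/andP; split; have := jm i; have := j0 i; lra.
congr chord; rewrite /bump /= -natr1; ring.
Qed.

(* Extremal polynomials: [X^n - r^n] with the zeros at distance at least 1
   from the point [- r]. *)
Lemma factor_constant_lbound : lbound (factor_constants (closed_disk r)) C.
Proof.
move=> c [c0 Hc].
rewrite -ler_ln ?posrE // ln_C -subr_le0.
have k1 : 1 <= chord r 0 := chord_ge1 _ _ _.
have k0 : 0 < chord r 0 := lt_le_trans ltr01 k1.
apply: (@ler0_of_mulrn_bounded _ ((ln 2 + ln (chord r 0)) / 2)) => m m0.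
pose n := (m + m)%N.
have n0 : (0 < n)%N by rewrite addn_gt0 m0.
have pn := @omega_prim R n n0.
pose rc : R[i] := (r%:C)%C.
have nrc : normc rc = r by rewrite normc_real gtr0_norm.
pose a (j : 'I_n) := rc * omega R n ^+ j.
(* Dropping exactly the factors below 1 at [- r] turns [|q(- r)|] into the product of truncated
   chords. *)
pose P j := 1 <= normc (- rc - a j).
pose p := \prod_j ('X - (a j)%:P).
pose q := \prod_(j | P j) ('X - (a j)%:P).
have pm : p \is monic by apply: monic_prod_XsubC.
have qp : monic_factor q p.
  split; first by apply: monic_prod_XsubC.
  by exists (\prod_(j | ~~ P j) ('X - (a j)%:P)); rewrite /p (bigID P).
have sp : size p = n.+1.
  by rewrite size_prod_XsubC [index_enum _]unlock -enumT size_enum_ord.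
have np : sup_norm (closed_disk r) p <= 2 * r ^+ n.
  apply: sup_norm_le => z zr.
  have -> : p.[z] = z ^+ n - rc ^+ n.
    rewrite -(prod_sub_unity_roots _ _ _ pn) horner_prod.
    by apply: eq_bigr => j _; rewrite !hornerE.
  apply: le_trans (le_normcD _ _) _; rewrite normcN !normcX nrc.
  rewrite mulr_natl mulr2n lerD2r lerXn2r ?nnegrE ?normc_ge0 //; exact: ltW.
have nq : normc q.[- rc] = \prod_(j < n) Num.max 1 (r * normc (1 + omega R n ^+ j)).
  rewrite horner_prod normc_prod big_mkcond; apply: eq_bigr => j _.
  have -> : r * normc (1 + omega R n ^+ j) = normc (- rc - a j).
    by rewrite -nrc -ComplexField.Normc.normcM -normcN; congr normc; rewrite /a; ring.
  rewrite /P; case: ifPn => h; first by rewrite !hornerE max_r.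
  by rewrite max_l // ltW // ltNge.
have := Hc _ _ pm qp; rewrite sp /= => H.
have {}H : normc q.[- rc] <= c ^+ n * (2 * r ^+ n).
  apply: le_trans (_ : sup_norm (closed_disk r) q <= _).
    by apply: le_sup_norm; rewrite normcN nrc.
  by apply: le_trans H _; rewrite ler_wpM2l ?exprn_ge0 // ltW.
have {}H : chord_prod r m ^+ 2 <= c ^+ n * (2 * r ^+ n) * chord r 0.
  by rewrite -prod_half_arc // ler_pM2r // -nq.
have G0 : 0 < chord_prod r m by apply: lt_le_trans ltr01 (chord_prod_ge1 _ _ _).
rewrite -ler_ln ?posrE ?mulr_gt0 ?exprn_gt0 ?mulr_gt0 ?exprn_gt0 // in H.
rewrite !(lnM, ln_expr) ?posrE ?mulr_gt0 ?exprn_gt0 ?mulr_gt0 ?exprn_gt0 // in H.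
rewrite natrD in H.
have /andP[+ _] := ln_chord_prodJ _ m0.
set S := ln (chord_prod r m) in H *; lra.
Qed.

End ClosedDisk.

Theorem corollary3p2 (R : realType) (r : R) (hr : 0 < r) :
  smallest_factor_constant (closed_disk r)
    (if r <= 1 / 2 then 1 / r
     else 1 / r * expR (1 / pi *
            \int[lebesgue_measure]_(x in `[0, pi - 2 * asin (1 / (2 * r))])
               ln (2 * r * cos (x / 2)))).
Proof.
pose J := 1 / pi * \int[lebesgue_measure]_(x in `[0, pi]) ln (chord r x).
have HJ m : (0 < m)%N ->
    m%:R * J <= ln (chord_prod r m) <= m%:R * J + ln (chord r 0).
  by move=> m0; apply: ln_chord_prod_bounds => //; exact: ltW.
(* Both cases of the formula are [exp(J) / r] with the truncated integrand over all of [0, pi]. *)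
suff -> : (if r <= 1 / 2 then 1 / r
     else 1 / r * expR (1 / pi *
            \int[lebesgue_measure]_(x in `[0, pi - 2 * asin (1 / (2 * r))])
               ln (2 * r * cos (x / 2)))) = 1 / r * expR J.
  split; [exact: factor_constant_mem HJ|exact: factor_constant_lbound HJ].
case: ifPn => [r1|]; last first.
  by rewrite -ltNge /J => r1; rewrite Rintegral_ln_chord.
rewrite /J; under eq_Rintegral => x _ do rewrite (ln_chord_small _ _ _ (ltW hr) r1).
by rewrite Rintegral_itv_cst ?pi_ge0 // !mulr0 expR0 mulr1.
Qed.
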